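(* Let $(X,p,E)$ be a $p$-complete lattice-normed vector lattice. The following statements are equivalent: (i) $X$ is $op$-continuous, i.e. $x_\alpha\xrightarrow{o}0$ in $X$ implies $p(x_\alpha)\xrightarrow{o}0$ in $E$; (ii) if $0\le x_\alpha\uparrow\le x$ holds in $X$, then $(x_\alpha)$ is a $p$-Cauchy net; (iii) $x_\alpha\downarrow 0$ in $X$ implies $p(x_\alpha)\downarrow 0$ in $E$.
   Context: All vector lattices are real and Archimedean. A net $(x_\alpha)_{\alpha\in A}$ in a vector lattice $X$ is order convergent to $x$ (written $x_\alpha\xrightarrow{o}x$) if there is a net $(y_\beta)_{\beta\in B}$ (possibly with a different index set) with $y_\beta\downarrow 0$ such that for each $\beta$ there is $\alpha_\beta$ with $|x_\alpha-x|\le y_\beta$ for all $\alpha\ge\alpha_\beta$. The notation $x_\alpha\downarrow 0$ means the net is decreasing with infimum $0$; $0\le x_\alpha\uparrow\le x$ means the net is increasing, positive and bounded above by $x$. A lattice-normed vector lattice (LNVL) is a triple $(X,p,E)$, where $X$ and $E$ are vector lattices and $p:X\to E_+$ satisfies: $p(x)=0\Leftrightarrow x=0$; $p(\lambda x)=|\lambda|p(x)$ for all $\lambda\in\mathbb{R}$, $x\in X$; $p(x+y)\le p(x)+p(y)$; and $|x|\le|y|\Rightarrow p(x)\le p(y)$. A net $x_\alpha$ $p$-converges to $x$ ($x_\alpha\xrightarrow{p}x$) if $p(x_\alpha-x)\xrightarrow{o}0$ in $E$. A net $(x_\alpha)_{\alpha\in A}$ is $p$-Cauchy if the net $(x_\alpha-x_{\alpha'})_{(\alpha,\alpha')\in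 A\times A}$ $p$-converges to $0$. $X$ is $p$-complete if every $p$-Cauchy net in $X$ is $p$-convergent in $X$. *)

(* Defs.v *)
From HB Require Import structures.
From mathcomp Require Import all_boot all_order all_algebra.
From mathcomp Require Import classical_sets reals.

Set Implicit Arguments.
Unset Strict Implicit.
Unset Printing Implicit Defensive.

Import Order.TTheory GRing.Theory Num.Theory.

Local Open Scope classical_set_scope.
Local Open Scope ring_scope.

(* X cannot be given an [Order.Lattice] structure next to its [lmodType] one:
   HB rejects a join of [Order.Lattice] and [GRing.Zmodule] declared after
   [Num.RealDomain], which inherits from both.  The order is therefore that of
   [Num.POrderedZmodule], and the binary suprema and infima come as
   operations. *)
HB.mixin Record isVectorLattice (R : realType) X
    of Num.POrderedZmodule X & GRing.Lmodule R X := {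
  vl_sup : X -> X -> X;
  vl_inf : X -> X -> X;
  vl_leD2r : forall z x y : X, x <= y -> x + z <= y + z;
  vl_scale_ge0 : forall (a : R) (x : X), 0 <= a -> 0 <= x -> 0 <= a *: x;
  vl_supP : forall x y : X, supremums [set x; y] (vl_sup x y);
  vl_infP : forall x y : X, infimums [set x; y] (vl_inf x y);
}.

#[short(type="vectorLatticeType")]
HB.structure Definition VectorLattice (R : realType) :=
  {X of isVectorLattice R X & Num.POrderedZmodule X & GRing.Lmodule R X}.

HB.mixin Record VectorLattice_isArchimedean (R : realType) X
    of VectorLattice R X := {
  vl_archimedean : forall x : X, 0 <= x ->
    infimums (range (fun n : nat => n.+1%:R^-1 *: x : X)) 0;
}.

#[short(type="archiVectorLatticeType")]
HB.structure Definition ArchiVectorLattice (R : realType) :=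
  {X of VectorLattice_isArchimedean R X & VectorLattice R X}.

Definition vl_abs (R : realType) (X : vectorLatticeType R) (x : X) : X :=
  vl_sup x (- x).

Record directedSet : Type := DirectedSet {
  dir_sort :> Type;
  dir_le : dir_sort -> dir_sort -> Prop;
  dir_le_refl : forall a, dir_le a a;
  dir_le_trans : forall a b c, dir_le a b -> dir_le b c -> dir_le a c;
  dir_inhabited : inhabited dir_sort;
  dir_directed : forall a b, exists c, dir_le a c /\ dir_le b c;
}.

Section DirectedProduct.
Variables A B : directedSet.

Definition dirprod_le (u v : A * B) : Prop :=
  dir_le u.1 v.1 /\ dir_le u.2 v.2.

Lemma dirprod_le_refl u : dirprod_le u u.
Proof. by split; exact: dir_le_refl. Qed.

Lemma dirprod_le_trans u v w :
  dirprod_le u v -> dirprod_le v w -> dirprod_le u w.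
Proof.
by move=> [uv1 uv2] [vw1 vw2]; split;
  [exact: dir_le_trans uv1 vw1|exact: dir_le_trans uv2 vw2].
Qed.

Lemma dirprod_inhabited : inhabited (A * B).
Proof.
by have [a] := dir_inhabited A; have [b] := dir_inhabited B; exists; exact: (a, b).
Qed.

Lemma dirprod_directed u v : exists w, dirprod_le u w /\ dirprod_le v w.
Proof.
have [c [uc vc]] := dir_directed u.1 v.1.
have [d [ud vd]] := dir_directed u.2 v.2.
by exists (c, d).
Qed.

Definition dirprod : directedSet :=
  DirectedSet dirprod_le_refl dirprod_le_trans dirprod_inhabited
    dirprod_directed.

End DirectedProduct.

Section Nets.
Variables (R : realType) (X : vectorLatticeType R).
Implicit Type A : directedSet.

Definition increasing_net A (x : A -> X) : Prop :=
  forall a b, dir_le a b -> x a <= x b.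

Definition decreasing_net A (x : A -> X) : Prop :=
  forall a b, dir_le a b -> x b <= x a.

Definition decreases_to A (x : A -> X) (l : X) : Prop :=
  decreasing_net x /\ infimums (range x) l.

(* The controlling net y may have its own index set B. *)
Definition order_cvg A (x : A -> X) (l : X) : Prop :=
  exists (B : directedSet) (y : B -> X),
    decreases_to y 0 /\
    forall b, exists a0, forall a, dir_le a0 a -> vl_abs (x a - l) <= y b.

End Nets.

(* [lattice_norm p] says that (X, p, E) is a lattice-normed vector lattice. *)
Record lattice_norm (R : realType) (X E : archiVectorLatticeType R)
    (p : X -> E) : Prop := LatticeNorm {
  lattice_norm_ge0 : forall x, 0 <= p x;
  lattice_norm_eq0 : forall x, p x = 0 <-> x = 0;
  lattice_normZ : forall (a : R) x, p (a *: x) = `|a| *: p x;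
  lattice_normD : forall x y, p (x + y) <= p x + p y;
  lattice_norm_mono : forall x y, vl_abs x <= vl_abs y -> p x <= p y;
}.

Section LatticeNormed.
Variables (R : realType) (X E : archiVectorLatticeType R) (p : X -> E).

Definition p_cvg (A : directedSet) (x : A -> X) (l : X) : Prop :=
  order_cvg (fun a => p (x a - l)) 0.

Definition p_cauchy (A : directedSet) (x : A -> X) : Prop :=
  p_cvg (fun u : dirprod A A => x u.1 - x u.2) 0.

Definition p_complete : Prop :=
  forall (A : directedSet) (x : A -> X),
    p_cauchy x -> exists l, p_cvg x l.

Definition op_continuous : Prop :=
  forall (A : directedSet) (x : A -> X),
    order_cvg x 0 -> order_cvg (fun a => p (x a)) 0.

End LatticeNormed.

(* Main.v *)
Require Import Defs.
From mathcomp Require Import all_boot all_order all_algebra.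
From mathcomp Require Import classical_sets reals.

(** In an Archimedean vector lattice a bounded increasing net [x] is order
    Cauchy, because the differences [y - x a], with [y] ranging over the upper
    bounds of [x], decrease to [0]; so op-continuity makes [x] p-Cauchy.  If
    bounded increasing nets are p-Cauchy, a net decreasing to [0] has a p-limit
    by p-completeness; a p-limit respects order bounds, so it is [0].  Finally,
    if [p] preserves decrease to [0], it carries the net controlling an
    order-null net to one controlling its image. *)

Local Open Scope ring_scope.

Set Implicit Arguments.
Unset Strict Implicit.
Unset Printing Implicit Defensive.

Import Order.TTheory GRing.Theory Num.Theory.

(** * Order arithmetic and absolute values in a vector lattice *)

Section VectorLatticeTheory.
Variables (R : realType) (X : vectorLatticeType R).
Implicit Types x y z w : X.

Lemma vl_leD x y z w : x <= y -> z <= w -> x + z <= y + w.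
Proof.
move=> xy zw; apply: (le_trans (vl_leD2r z _ _ xy)).
by rewrite ![y + _]addrC; exact: vl_leD2r.
Qed.

Lemma vl_subr_ge0 x y : (0 <= y - x) = (x <= y).
Proof.
apply/idP/idP => [/(vl_leD2r x)|/(vl_leD2r (- x))]; last by rewrite subrr.
by rewrite add0r subrK.
Qed.

Lemma vl_leBrDr x y z : (x <= y - z) = (x + z <= y).
Proof. by rewrite -vl_subr_ge0 -[RHS]vl_subr_ge0 opprD addrA addrAC. Qed.

Lemma vl_leBlDr x y z : (x - z <= y) = (x <= y + z).
Proof. by rewrite -[y in LHS](addrK z) vl_leBrDr subrK. Qed.

Lemma vl_leB2l x y z : x <= y -> z - y <= z - x.
Proof.
move=> xy; rewrite vl_leBlDr addrAC vl_leBrDr.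
by rewrite ![z + _]addrC; exact: vl_leD2r.
Qed.

Lemma vl_sup_ubl x y : x <= vl_sup x y.
Proof. by have [+ _] := vl_supP x y; apply; left. Qed.

Lemma vl_sup_ubr x y : y <= vl_sup x y.
Proof. by have [+ _] := vl_supP x y; apply; right. Qed.

Lemma vl_sup_le x y z : x <= z -> y <= z -> vl_sup x y <= z.
Proof. by move=> xz yz; have [_] := vl_supP x y; apply => _ [->|->]. Qed.

Lemma vl_inf_lbl x y : vl_inf x y <= x.
Proof. by have [+ _] := vl_infP x y; apply; left. Qed.

Lemma vl_inf_lbr x y : vl_inf x y <= y.
Proof. by have [+ _] := vl_infP x y; apply; right. Qed.

Lemma vl_le_inf x y z : z <= x -> z <= y -> z <= vl_inf x y.
Proof. by move=> zx zy; have [_] := vl_infP x y; apply => _ [->|->]. Qed.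

Lemma vl_abs_ge x : x <= vl_abs x.
Proof. exact: vl_sup_ubl. Qed.

Lemma vl_abs_geN x : - x <= vl_abs x.
Proof. exact: vl_sup_ubr. Qed.

(** Adding the bounds by [x] and [- x] gives twice the absolute value at least 0; scaling by one
    half concludes. *)
Lemma vl_abs_ge0 x : 0 <= vl_abs x.
Proof.
have h : 0 <= vl_abs x + vl_abs x.
  by rewrite -(subrr x); exact: vl_leD (vl_abs_ge x) (vl_abs_geN x).
have h2 : 0 <= (2%:R : R)^-1 by rewrite invr_ge0 ler0n.
have := vl_scale_ge0 _ _ h2 h.
by rewrite -mulr2n -scaler_nat scalerA mulVf ?scale1r // pnatr_eq0.
Qed.

Lemma vl_abs_le x y : x <= y -> - x <= y -> vl_abs x <= y.
Proof. exact: vl_sup_le. Qed.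

Lemma vl_ge0_abs x : 0 <= x -> vl_abs x = x.
Proof.
move=> x0; apply/le_anti; rewrite vl_abs_ge andbT vl_abs_le //.
by apply: (le_trans _ x0); rewrite -vl_subr_ge0 sub0r opprK.
Qed.

Lemma le_vl_abs x y : 0 <= x -> x <= vl_abs y -> vl_abs x <= vl_abs y.
Proof. by move=> x0; rewrite (vl_ge0_abs x0). Qed.

End VectorLatticeTheory.

(** * The upper bounds of a bounded net as an index set *)

Section DownwardDirected.
Variables (R : realType) (X : vectorLatticeType R) (A : directedSet).
Variables (x : A -> X) (z : X).
Hypothesis xz : forall a, x a <= z.

Let upper := {y : X | forall a, x a <= y}.

(** The order is reversed so that a net running through the upper bounds decreases; directedness
    then comes from binary infima. *)
Definition upper_le (u v : upper) : Prop := sval v <= sval u.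

Lemma upper_le_refl u : upper_le u u.
Proof. exact: lexx. Qed.

Lemma upper_le_trans u v w : upper_le u v -> upper_le v w -> upper_le u w.
Proof. by move=> uv vw; exact: le_trans vw uv. Qed.

Lemma upper_inhabited : inhabited upper.
Proof. by exists; exists z. Qed.

Lemma upper_directed u v : exists w, upper_le u w /\ upper_le v w.
Proof.
have uvP a : x a <= vl_inf (sval u) (sval v).
  by apply: vl_le_inf; [exact: (svalP u)|exact: (svalP v)].
by exists (exist _ _ uvP); split; [exact: vl_inf_lbl|exact: vl_inf_lbr].
Qed.

Definition upper_bounds : directedSet :=
  DirectedSet upper_le_refl upper_le_trans upper_inhabited upper_directed.

End DownwardDirected.

(** * Bounded increasing nets in Archimedean vector lattices *)

Section ArchimedeanNets.
Variables (R : realType) (X : archiVectorLatticeType R).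

(** Dividing by [n.+1] puts [w] below every [n.+1%:R^-1 *: z], a family with infimum 0. *)
Lemma archimedean_le0 (w z : X) :
  0 <= z -> (forall n : nat, w *+ n <= z) -> w <= 0.
Proof.
move=> z0 wz; have [_ inf0] := vl_archimedean z z0.
apply: inf0 => _ [n _ <-].
have n0 : 0 <= (n.+1%:R : R)^-1 by rewrite invr_ge0 ler0n.
have := wz n.+1; rewrite -vl_subr_ge0 => /(vl_scale_ge0 _ _ n0).
by rewrite scalerBr -scaler_nat scalerA mulVf ?pnatr_eq0 // scale1r vl_subr_ge0.
Qed.

Lemma upper_gap_decreases_to0 (A : directedSet) (x : A -> X) (z : X)
    (xz : forall a, x a <= z) :
  increasing_net x -> (forall a, 0 <= x a) ->
  decreases_to (fun u : dirprod (upper_bounds xz) A => sval u.1 - x u.2) 0.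
Proof.
move=> xinc x0; split=> [[u a] [v b] [/= uv ab]|].
  exact: le_trans (vl_leD2r _ _ _ uv) (vl_leB2l _ (xinc _ _ ab)).
split=> [_ [[u a] _ <-]|w wlb] /=; first by rewrite vl_subr_ge0; exact: (svalP u).
have [a0] := dir_inhabited A.
(* Subtracting a lower bound [w] of the gaps from an upper bound of [x] leaves an upper bound, so
   this can be iterated from [z]. *)
have ub (n : nat) : forall a, x a <= z - w *+ n.
  elim: n => [|n IH] a; first by rewrite mulr0n subr0.
  have : w <= z - w *+ n - x a.
    by apply: wlb; exists (exist _ _ IH, a).
  by rewrite vl_leBrDr addrC -vl_leBrDr mulrSr opprD addrA.
apply: (@archimedean_le0 w z) => [|n]; first exact: le_trans (x0 a0) (xz a0).
by have := le_trans (x0 a0) (ub n a0); rewrite vl_subr_ge0.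
Qed.

Lemma bounded_increasing_order_cauchy (A : directedSet) (x : A -> X) (z : X) :
  increasing_net x -> (forall a, 0 <= x a) -> (forall a, x a <= z) ->
  order_cvg (fun u : dirprod A A => x u.1 - x u.2) 0.
Proof.
move=> xinc x0 xz.
exists (dirprod (upper_bounds xz) A), (fun u => sval u.1 - x u.2).
split=> [|[u b]]; first exact: upper_gap_decreases_to0.
(* Past [b] all terms lie between [x b] and [sval u], so differences of either sign are at most
   [sval u - x b]. *)
exists (b, b) => -[a a'] [/= ba ba']; rewrite subr0.
have gap c c' : dir_le b c' -> x c - x c' <= sval u - x b.
  move=> bc'; apply: le_trans (vl_leB2l _ (xinc _ _ bc')).
  by apply: vl_leD2r; exact: (svalP u).
by apply: vl_abs_le; rewrite ?opprB; exact: gap.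
Qed.

End ArchimedeanNets.

(** * Order bounds on p-limits *)

Section LatticeNormTheory.
Variables (R : realType) (X E : archiVectorLatticeType R) (p : X -> E).
Hypothesis p_norm : lattice_norm p.

Let p_ge0 := lattice_norm_ge0 p_norm.

Lemma p_cvg_dominated (A : directedSet) (x : A -> X) (l : X) : p_cvg p x l ->
  exists (B : directedSet) (e : B -> E), decreases_to e 0 /\
    forall b, exists a0, forall a, dir_le a0 a -> p (x a - l) <= e b.
Proof.
move=> [B [e [e0 h]]]; exists B, e; split=> // b.
have [a0 ha] := h b; exists a0 => a /ha.
by rewrite subr0 vl_ge0_abs.
Qed.

(** The positive part of [v] is eventually below the absolute value of [x a - l], so its norm is
    below every term of the controlling net and vanishes. Taking [v - l] or [l - v] for [v]
    transfers order bounds to p-limits. *)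
Lemma p_cvg_le_abs (A : directedSet) (x : A -> X) (l v : X) (a1 : A) :
  p_cvg p x l -> (forall a, dir_le a1 a -> v <= vl_abs (x a - l)) -> v <= 0.
Proof.
move=> /p_cvg_dominated[B [e [[_ [_ einf]] he]]] vx.
suff /(lattice_norm_eq0 p_norm) <- : p (vl_sup v 0) = 0 by exact: vl_sup_ubl.
apply/le_anti; rewrite p_ge0 andbT; apply: einf => _ [b _ <-].
have [a0 ha] := he b; have [c [a0c a1c]] := dir_directed a0 a1.
apply: le_trans (ha c a0c); apply: (lattice_norm_mono p_norm).
by apply: le_vl_abs; [exact: vl_sup_ubr|apply: vl_sup_le (vx c a1c) (vl_abs_ge0 _)].
Qed.

Lemma p_cvg_ge (A : directedSet) (x : A -> X) (l v : X) (a1 : A) :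
  p_cvg p x l -> (forall a, dir_le a1 a -> v <= x a) -> v <= l.
Proof.
move=> xl vx; rewrite -[l]add0r -vl_leBlDr.
apply: (p_cvg_le_abs (a1 := a1) xl) => a /vx vxa.
by apply: le_trans (vl_abs_ge _); exact: vl_leD2r.
Qed.

Lemma p_cvg_le (A : directedSet) (x : A -> X) (l v : X) (a1 : A) :
  p_cvg p x l -> (forall a, dir_le a1 a -> x a <= v) -> l <= v.
Proof.
move=> xl xv; rewrite -[v]add0r -vl_leBlDr.
apply: (p_cvg_le_abs (a1 := a1) xl) => a /xv xva.
by apply: le_trans (vl_abs_geN _); rewrite opprB; exact: vl_leB2l.
Qed.

End LatticeNormTheory.

(** * The cycle of implications *)

Section Equivalence.
Variables (R : realType) (X E : archiVectorLatticeType R) (p : X -> E).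
Hypothesis p_norm : lattice_norm p.

Let bounded_increasing_p_cauchy := forall (A : directedSet) (x : A -> X) (z : X),
  increasing_net x -> (forall a, 0 <= x a) -> (forall a, x a <= z) ->
  p_cauchy p x.

Let norm_decreases_to0 := forall (A : directedSet) (x : A -> X),
  decreases_to x 0 -> decreases_to (fun a => p (x a)) 0.

Lemma op_continuous_p_cauchy : op_continuous p -> bounded_increasing_p_cauchy.
Proof.
move=> opc A x z xinc x0 xz.
have [B [e [e0 h]]] := opc _ _ (bounded_increasing_order_cauchy xinc x0 xz).
exists B, e; split=> // b; have [a0 ha] := h b.
by exists a0 => a /ha; rewrite (subr0 (x a.1 - x a.2)).
Qed.

(** Subtracting the net from a fixed term [x a0] makes it increasing and bounded. Its p-limit is
    [x a0], so the norms of [x] are eventually dominated by a net decreasing to 0. *)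
Lemma p_cauchy_norm_decreases : p_complete p ->
  bounded_increasing_p_cauchy -> norm_decreases_to0.
Proof.
move=> pc cau A x [xdec [xlb xinf]].
have x0 a : 0 <= x a by apply: xlb; exists a.
split=> [a b ab|].
  apply: (lattice_norm_mono p_norm); rewrite !vl_ge0_abs //; exact: xdec.
split=> [_ [a _ <-]|w wlb]; first exact: (lattice_norm_ge0 p_norm).
have [a0] := dir_inhabited A.
(* The truncation makes the increasing net nonnegative on all of A and agrees
   with x past a0. *)
pose y a := x a0 - vl_inf (x a) (x a0).
have yE a : dir_le a0 a -> y a = x a0 - x a.
  move=> a0a; congr (_ - _); apply/le_anti; rewrite vl_inf_lbl.
  by apply: vl_le_inf => //; exact: xdec.
have y_le a : y a <= x a0.
  by rewrite vl_leBlDr -[X in X <= _]addr0; apply: vl_leD => //; exact: vl_le_inf.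
have [l yl] : exists l, p_cvg p y l.
  apply: pc; apply: (cau _ _ (x a0)) => [a b ab|a|a].
  - apply: vl_leB2l; apply: vl_le_inf; last exact: vl_inf_lbr.
    exact: le_trans (vl_inf_lbl _ _) (xdec _ _ ab).
  - by rewrite vl_subr_ge0; exact: vl_inf_lbr.
  - exact: y_le.
(* For the lower estimate, [x a0 - l] is a lower bound of [x]: past any [a], [y] stays above
   [x a0 - x a], hence so does [l]. *)
have lE : l = x a0.
  apply/le_anti; rewrite (p_cvg_le p_norm (a1 := a0) yl) //=.
  rewrite -[l]add0r -vl_leBlDr; apply: xinf => _ [a _ <-].
  rewrite vl_leBlDr addrC -vl_leBlDr.
  apply: (p_cvg_ge p_norm (a1 := a) yl) => b ab; apply: vl_leB2l.
  exact: le_trans (vl_inf_lbl _ _) (xdec _ _ ab).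
have [B [e [[_ [_ einf]] he]]] := p_cvg_dominated p_norm yl.
apply: einf => _ [b _ <-].
have [a1 ha] := he b; have [c [a0c a1c]] := dir_directed a0 a1.
apply: le_trans (ha c a1c).
(* Past [a0], [y c - l] is just [- x c], which has the norm of [x c]. *)
rewrite yE // lE addrAC subrr add0r.
apply: le_trans (_ : p (x c) <= _); first by apply: wlb; exists c.
by rewrite -scaleN1r (lattice_normZ p_norm) normrN1 scale1r.
Qed.

Lemma norm_decreases_op_continuous : norm_decreases_to0 -> op_continuous p.
Proof.
move=> dec A x [B [y [y0 h]]]; exists B, (fun b => p (y b)).
split=> [|b]; first exact: dec.
have [a0 ha] := h b; exists a0 => a /ha xy.
rewrite subr0 vl_ge0_abs; last exact: (lattice_norm_ge0 p_norm).
(* Monotonicity of [p] compares absolute values, so the bound [y b] is enlarged to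
   [vl_abs (y b)]. *)
apply: (lattice_norm_mono p_norm); rewrite subr0 in xy.
exact: le_trans xy (vl_abs_ge _).
Qed.

End Equivalence.

Theorem theorem2p9 (R : realType) (X E : archiVectorLatticeType R) (p : X -> E)
    (p_norm : lattice_norm p) (X_complete : p_complete p) :
  (op_continuous p <->
   (forall (A : directedSet) (x : A -> X) (z : X),
      increasing_net x -> (forall a, 0 <= x a) -> (forall a, x a <= z) ->
      p_cauchy p x)) /\
  ((forall (A : directedSet) (x : A -> X) (z : X),
      increasing_net x -> (forall a, 0 <= x a) -> (forall a, x a <= z) ->
      p_cauchy p x) <->
   (forall (A : directedSet) (x : A -> X),
      decreases_to x 0 -> decreases_to (fun a => p (x a)) 0)).
Proof.
have i_ii := @op_continuous_p_cauchy R X E p.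
have ii_iii := p_cauchy_norm_decreases p_norm X_complete.
have iii_i := norm_decreases_op_continuous p_norm.
by split; split=> // h; [exact/iii_i/ii_iii|exact/i_ii/iii_i].
Qed.
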